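(* Let $\{f(p)\}_{p \text{ prime}}$ be independent random variables, each uniformly distributed on $\{-1,+1\}$, and extend to a random completely multiplicative function $f:\mathbb{N}\to\{\pm1\}$ by $f(n)=\prod_{p^k\,\|\, n} f(p)^k$ (so $f(1)=1$). For $N\ge 1$ let \[ P_{f,N}(X)=\sum_{n=1}^{N} f(n)X^{n-1}\in\mathbb{Z}[X]. \] Then, with $N=2^k$, \[ \lim_{k\to\infty}\mathbb{P}\big[P_{f,N}(X)\text{ is irreducible over }\mathbb{Q}\big]=1. \]
   Context: Irreducibility is in $\mathbb{Q}[X]$. *)

(* Defs.v *)
From HB Require Import structures.
From mathcomp Require Import all_boot all_order all_algebra.
From mathcomp Require Import all_classical all_reals all_analysis.
Set Implicit Arguments.
Unset Strict Implicit.
Unset Printing Implicit Defensive.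
Import Order.TTheory GRing.Theory Num.Theory.
Import numFieldNormedType.Exports.
Local Open Scope classical_set_scope.
Local Open Scope ring_scope.

(* The library gives [bool] and [nat] the discrete sigma-algebra, but not
   [int], and a measurable type must be pointed. *)
HB.instance Definition _ := isPointed.Build int 0.

HB.instance Definition _ := @isMeasurable.Build default_measure_display int
  (@discrete_measurable int) (@discrete_measurable0 int)
  (@discrete_measurableC int) (@discrete_measurableU int).

(* Independence of the subfamily indexed by [A]; the [X i] with [i] outside [A]
   are unconstrained. *)
Definition mutually_independent (R : realType) (d : measure_display)
    (T : measurableType d) (P : probability T R) (d' : measure_display)
    (U : measurableType d') (I : eqType) (A : {pred I})
    (X : I -> {RV P >-> U}) : Prop :=
  forall J : seq I, uniq J -> {subset J <= A} ->
  forall B : I -> set U, (forall i, measurable (B i)) ->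
    P (\big[setI/setT]_(i <- J) (X i @^-1` B i)) =
    (\prod_(i <- J) P (X i @^-1` B i))%E.

Definition uniform_sign (R : realType) (d : measure_display)
    (T : measurableType d) (P : probability T R) (X : {RV P >-> int}) : Prop :=
  distribution P X [set 1] = (2^-1)%:E /\
  distribution P X [set -1] = (2^-1)%:E.

Definition completely_multiplicative_extension (f : nat -> int) (n : nat)
    : int :=
  \prod_(p <- primes n) f p ^+ logn p n.

Definition partial_sum_poly (f : nat -> int) (N : nat) : {poly int} :=
  \sum_(1 <= n < N.+1)
    (completely_multiplicative_extension f n)%:P * 'X^(n.-1).

Definition irreducible_over_rat (p : {poly int}) : Prop :=
  irreducible_poly (map_poly (intr : int -> rat) p).

(* Main.v *)
(** Write N = 2^k and let c_j be the coefficients of P(X + 1).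

    Modulo 2, P(X + 1) is X^(N-1), so in a factorization P = GH over Z all
    coefficients of G(X + 1) and H(X + 1) below the leading one are even, and
    4 divides c_j for every j < min (deg G, deg H).  Hence, as soon as 4 does
    not divide c_j, a reducible P has a factor of degree at most j.

    Since 'C(n - 1, 2^t - 1) is odd exactly when 2^t divides n, flipping the
    sign of a prime p in (N/2^(t+1), N/2^t] changes c_(2^t-1) by 2 modulo 4,
    whereas flipping a prime in (N/2^(s+1), N/2^s] with s < t leaves
    c_(2^t-1) unchanged modulo 4.  As there are such primes for every t < r
    (Bertrand's postulate), the probability that 4 divides c_(2^t-1) for all
    t < r is at most 1/r.

    The roots of P have modulus at most 2, so a factor of degree less than 2^r
    belongs to a finite set which does not depend on N.  Each of its members
    divides P with probability tending to 0: if z is one of its roots, the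
    signs of the primes p in (N/2, N] enter P(z) only through the independent
    terms f(p) z^(p-1), which is handled by a Littlewood-Offord argument, the
    number of these primes tending to infinity (Erdos' proof of Bertrand's
    postulate). *)

Require Import Defs.
From mathcomp Require Import all_boot all_order all_algebra.
From mathcomp Require Import all_classical all_reals all_analysis.
From mathcomp Require Import algC zify ring lra.
Set Implicit Arguments.
Unset Strict Implicit.
Unset Printing Implicit Defensive.
Import Order.TTheory GRing.Theory Num.Theory.
Import numFieldNormedType.Exports.

(** * Counting sign patterns *)

Definition flip (I : finType) (a : I) (A : {set I}) : {set I} :=
  [set i | (i \in A) (+) (i == a)].

Lemma flipK (I : finType) (a : I) : involutive (flip a).
Proof. by move=> A; apply/finset.setP => i; rewrite !inE addbK. Qed.

Lemma card_setT (I : finType) : #|{set I}| = 2 ^ #|I|.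
Proof.
rewrite -(cardsT I) -card_powerset; apply: eq_card => A.
by rewrite !inE finset.subsetT.
Qed.

(** Double counting of the pairs (a, B) with [flip a B] in [E]: as [flip a] is an involution, each a
    in [D] occurs in exactly #|E| of them. *)
Lemma flip_count (I : finType) (E : {set {set I}}) (D : {set I}) (L : nat) :
  (forall B, #|[set a in D | flip a B \in E]| <= L) ->
  #|E| * #|D| <= L * 2 ^ #|I|.
Proof.
move=> EL.
have -> : #|E| * #|D| = \sum_(B : {set I}) #|[set a in D | flip a B \in E]|.
  rewrite mulnC -sum_nat_const.
  under [RHS]eq_bigr => B _ do rewrite -sum1dep_card big_mkcondr.
  rewrite exchange_big /=; apply: eq_bigr => a _.
  rewrite -big_mkcond /= (reindex_inj (inv_inj (@flipK _ a))) /=.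
  by rewrite -sum1_card; apply: eq_bigl => A; rewrite flipK.
rewrite mulnC -card_setT -sum_nat_const.
exact: leq_sum.
Qed.

(** The squared form of 'C(2n, n) = O(4^n / sqrt n); the induction step reduces to (2n + 1)(2n + 3)
    <= 4(n + 1)^2. *)
Lemma central_binomial_sqr n : 'C(n.*2, n) ^ 2 * n.*2.+1 <= 16 ^ n.
Proof.
elim: n => [//|n IH].
have e : n.+1 * 'C(n.+1.*2, n.+1) = 2 * n.*2.+1 * 'C(n.*2, n).
  have h1 := mul_bin_diag n.*2.+2 n; have h2 := mul_bin_down n.*2.+1 n.
  rewrite /= in h1 h2; rewrite doubleS -h1.
  have -> : n.*2.+2 = 2 * n.+1 by lia.
  have h3 : n.*2.+1 - n = n.+1 by lia.
  by rewrite -!mulnA -h3 -h2.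
rewrite -(leq_pmul2l (m := n.+1 ^ 2)) ?expn_gt0 // mulnA -expnMn e.
rewrite !expnMn (expnS 16) doubleS.
set c := 'C(_, _) in IH *; set w := 16 ^ n in IH *.
have -> : 2 ^ 2 * n.*2.+1 ^ 2 * c ^ 2 * n.*2.+3 =
          4 * (n.*2.+1 * n.*2.+3) * (c ^ 2 * n.*2.+1).
  by rewrite -mulnn; ring.
have -> : n.+1 ^ 2 * (16 * w) = 4 * (4 * n.+1 ^ 2) * w by ring.
apply: leq_mul IH; rewrite leq_mul2l /= -mulnn; lia.
Qed.

Lemma bin_le_central n c : 'C(n.*2, c) <= 'C(n.*2, n).
Proof.
have up i : 'C(n.*2, n + i) <= 'C(n.*2, n).
  elim: i => [|i IH]; first by rewrite addn0.
  apply: leq_trans IH; rewrite addnS -(leq_pmul2l (m := (n + i).+1)) //.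
  by rewrite mul_bin_left leq_mul2r; apply/orP; right; lia.
have [le_nc|/ltnW le_cn] := leqP n c; first by rewrite -(subnKC le_nc).
rewrite -bin_sub; last by lia.
by have -> : n.*2 - c = n + (n - c) by lia.
Qed.

(** For even m this is the central bound; Pascal's rule writes an entry of an odd row as a sum of
    two entries of the even row before it. *)
Lemma bin_anticoncentration q m c : q ^ 2 <= m -> 'C(m, c) * q <= 2 ^ m.
Proof.
have even n d : q ^ 2 <= n.*2.+1 -> 'C(n.*2, d) * q <= 2 ^ n.*2.
  move=> le_qn; rewrite -leq_sqr expnMn -expnM muln2 -!mul2n mulnA.
  rewrite [2 ^ _]expnM.
  apply: leq_trans (central_binomial_sqr n).
  by rewrite leq_mul ?leq_sqr ?mul2n ?bin_le_central.
move=> le_qm; have := odd_double_half m; case: (odd m) => /= em; last first.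
  by rewrite -em; apply: even; lia.
have le_q : q ^ 2 <= m./2.*2.+1 by lia.
rewrite -em add1n; case: c => [|c]; last first.
  have := even _ c.+1 le_q; have := even _ c le_q; rewrite binS expnS; lia.
have := even m./2 0 le_q; rewrite !bin0 expnS; lia.
Qed.

(** Among the members of [E] with a prescribed trace outside [C], the size c of the trace on [C] is
    fixed, which leaves at most 'C(#|C|, c) of them. *)
Lemma slice_count (I : finType) (E : {set {set I}}) (C : {set I}) (q : nat) :
  (forall A B, A \in E -> B \in E -> A :\: C = B :\: C ->
    #|A :&: C| = #|B :&: C|) ->
  q ^ 2 <= #|C| -> #|E| * q <= 2 ^ #|I|.
Proof.
move=> slice le_qC.
rewrite -sum1_card (partition_big (fun A => A :\: C) (fun B => B \in powerset (~: C)));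
  last by move=> A _; rewrite powersetE finset.setDE finset.subsetIr.
rewrite big_distrl /= -(cardsC C) expnD -[2 ^ #|~: C|]card_powerset.
rewrite [leqRHS]mulnC -sum_nat_const.
apply: leq_sum => B _; rewrite sum1dep_card.
have [->|[A0]] := set_0Vmem [set A in E | A :\: C == B]; first by rewrite cards0.
rewrite inE => /andP[A0E /eqP A0B].
apply: leq_trans (bin_anticoncentration #|A0 :&: C| le_qC).
rewrite leq_mul2r -cards_draws; apply/orP; right.
rewrite -(card_in_imset (f := fun A => A :&: C)); last first.
  move=> A A'; rewrite !inE => /andP[_ /eqP AB] /andP[_ /eqP A'B] AA'.
  by rewrite -(finset.setID A C) AA' AB -A'B finset.setID.
apply/subset_leq_card/fintype.subsetP => X /imsetP[A].
rewrite inE => /andP[AE /eqP AB ->].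
by rewrite inE finset.subsetIr (slice A A0) ?eqxx ?AB.
Qed.

Local Open Scope ring_scope.

Lemma sign_flip (F : numFieldType) (I : finType) (B : {set I}) (a b : I) :
  (-1) ^+ (b \in flip a B) =
  (if b == a then -1 else 1) * (-1) ^+ (b \in B) :> F.
Proof. by rewrite inE signr_addb mulrC; case: (b == a). Qed.

(* If many of the [v a] coincide, the number of minus signs among them is
   determined by the other signs, and a binomial bound applies.  Otherwise two
   solutions leading to the same pattern by flipping [a] and [b] satisfy
   [v a = v b] or [v a = - v b], so few [a] lead to a given pattern. *)
Lemma littlewood_offord (F : numFieldType) (q : nat) :
  exists m : nat, forall (I : finType) (D : {set I}) (v : I -> F)
    (r : {set I} -> F),
  (m <= #|D|)%N -> (forall a, a \in D -> v a != 0) ->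
  (#|[set A : {set I} |
      (r (A :\: D) + \sum_(a in D) (-1) ^+ (a \in A) * v a == 0)%R]| * q
    <= 2 ^ #|I|)%N.
Proof.
have [->|q_gt0] := posnP q; first by exists 0 => *; rewrite muln0.
(* Without a class of [q ^ 2] equal values, at most 2 q^2 elements a lead to one pattern; q times
   this number is the size required of [D]. *)
exists (2 * q ^ 2 * q)%N => I D v r le_mD v_neq0.
set E := [set A | _].
pose cls c := [set b in D | v b == c].
have [/exists_inP[a aD le_q]|] :=
  boolP [exists a in D, q ^ 2 <= #|cls (v a)|]%N.
  apply: slice_count le_q => A B; rewrite !inE.
  have split_sum (X : {set I}) : \sum_(b in D) (-1) ^+ (b \in X) * v b =
      \sum_(b in D | v b != v a) (-1) ^+ (b \in X :\: cls (v a)) * v b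
      + v a * (#|cls (v a)|%:R - #|X :&: cls (v a)|%:R *+ 2).
    rewrite (bigID (fun b => v b == v a)) /= addrC; congr (_ + _).
      by apply: eq_bigr => b /andP[bD /negPf vb]; rewrite !inE bD vb.
    transitivity (\sum_(b in cls (v a)) v a * (1 - (b \in X)%:R *+ 2)).
      apply: eq_big => [b|b /andP[_ /eqP->]]; first by rewrite inE.
      by rewrite mulrC; case: (b \in X); rewrite /= ?expr1 ?expr0; ring.
    rewrite -mulr_sumr; congr (_ * _).
    rewrite sumrB sumr_const sumrMnl -natr_sum; congr (_ - _%:R *+ _).
    by rewrite -big_mkcondr sum1dep_card; apply: eq_card => b; rewrite !inE andbC.
  move=> /eqP hA /eqP hB AB.
  have ABD : A :\: D = B :\: D.
    have sub : cls (v a) \subset D by apply/fintype.subsetP => b; rewrite inE => /andP[].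
    by rewrite -(finset.setUidPr sub) -!finset.setDDl AB.
  have := etrans hA (esym hB); rewrite !split_sum ABD AB => /addrI /addrI.
  move=> /(mulfI (v_neq0 _ aD)) /addrI /oppr_inj /eqP.
  by rewrite -!mulrnA eqr_nat => /eqP; lia.
rewrite negb_exists_in => /forall_inP small.
have cls_le c : (#|cls c| <= q ^ 2)%N.
  have [->|[a]] := set_0Vmem (cls c); first by rewrite cards0.
  by rewrite inE => /andP[aD /eqP <-]; rewrite ltnW // ltnNge small.
suff : (#|E| * #|D| <= 2 * q ^ 2 * 2 ^ #|I|)%N.
  move=> le_ED; rewrite -(leq_pmul2l (m := (2 * q ^ 2)%N)) ?muln_gt0 ?expn_gt0 ?q_gt0 //.
  by apply: leq_trans le_ED; rewrite mulnCA leq_mul2l le_mD orbT.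
apply: flip_count => B.
(* Flipping a in [D] subtracts twice the signed [v a] from the total, so the result vanishes exactly
   when that signed value is [s]. *)
pose s := (r (B :\: D) + \sum_(b in D) (-1) ^+ (b \in B) * v b) / 2.
rewrite mul2n -addnn; apply: leq_trans (leq_add (cls_le s) (cls_le (- s))).
apply: leq_trans (leq_card_setU _ _); apply/subset_leq_card/fintype.subsetP => a.
rewrite !inE => /andP[aD].
have -> : flip a B :\: D = B :\: D.
  by apply/finset.setP => b; rewrite !inE; case: eqP => [->|]; rewrite ?aD ?addbF.
rewrite aD /= (bigD1 a) //= sign_flip eqxx.
under eq_bigr => b /andP[_ /negPf ba] do rewrite sign_flip ba mul1r.
rewrite /s (bigD1 (P := mem D) a) //=.
move: (\sum_(_ in _ | _) _) (r _) => x y.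
case: (a \in B); rewrite /= ?expr0 ?expr1 => /eqP h; apply/orP; [right|left].
  have -> : y + (-1 * v a + x) = - (v a + v a).
    by apply/eqP; rewrite -subr_eq0 -h; apply/eqP; ring.
  by apply/eqP; field.
have -> : y + (1 * v a + x) = v a + v a.
  by apply/eqP; rewrite -subr_eq0 -h; apply/eqP; ring.
by apply/eqP; field.
Qed.

Local Open Scope nat_scope.

(** * Primes between 2^k and 2^(k+1) *)

Lemma prod_logn (X m : nat) : 0 < X ->
  (forall p, prime p -> m < p -> ~~ (p %| X)) ->
  X = \prod_(0 <= p < m.+1) p ^ logn p X.
Proof.
move=> X0 big; rewrite -[LHS]partnT // (@widen_partn (maxn X m)) ?leq_maxl //.
rewrite (big_cat_nat (n := m.+1)) ?ltnS ?leq_maxr //=.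
rewrite [X in _ * X]big1_seq ?muln1 // => p; rewrite mem_index_iota => /and3P[_ mp _].
have [pp|np] := boolP (prime p); last by rewrite lognE (negPf np).
by rewrite lognE (negPf (big _ pp mp)) X0 pp.
Qed.

Lemma prime_dvd_fact p n : prime p -> (p %| n`!) = (p <= n).
Proof.
move=> pp; have [le_pn|lt_np] := leqP p n; first by rewrite dvdn_fact ?prime_gt0.
elim: n lt_np => [|n IH] lt_np; first by rewrite dvdn1; apply/eqP => p1; rewrite p1 in pp.
by rewrite factS Euclid_dvdM // IH 1?ltnW // orbF gtnNdvd.
Qed.

(** Erdos' induction: an even n > 2 is not prime, and for n = 2m + 1 the primes in (m + 1, n] all
    divide 'C(n, m) <= 4^m. *)
Lemma primorial_le n : \prod_(0 <= p < n.+1 | prime p) p <= 4 ^ n.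
Proof.
elim/ltn_ind: n => n IH.
have [n2|n2] := leqP n 2.
  by case: n n2 {IH} => [|[|[|]]] // _; rewrite unlock.
have := odd_double_half n; case en: (odd n) => /= nE; last first.
  rewrite big_mkcond big_nat_recr //= ifF ?muln1; last first.
    by apply/negP => /even_prime[|]; [lia|rewrite en].
  rewrite -big_mkcond /=; case: n n2 IH en nE => // n n2 IH _ _.
  by apply: leq_trans (IH n _) _ => //; rewrite leq_exp2l.
move: n./2 nE => m nE.
rewrite (big_cat_nat (n := m.+2)) //=; last by lia.
have -> : 4 ^ n = 4 ^ m.+1 * 4 ^ m by rewrite -expnD; congr (_ ^ _); lia.
apply: leq_mul; first by apply: IH; lia.
have X0 : 0 < 'C(n, m) by rewrite bin_gt0; lia.
have fE := @bin_fact n m ltac:(lia).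
apply: (@leq_trans 'C(n, m)); last first.
  rewrite -(leq_pmul2r (m := 2)) //.
  (* Anticoncentration with q = 2 needs n >= 4, so n = 3 is treated apart. *)
  have [m1|m1] := leqP m 1; first by have [-> ->] : m = 1 /\ n = 3 by lia.
  have -> : 4 ^ m * 2 = 2 ^ n by rewrite -[4]/(2 ^ 2) -expnM -expnSr; congr (_ ^ _); lia.
  by apply: bin_anticoncentration; lia.
rewrite [leqRHS](@prod_logn _ n X0); last first.
  move=> p pp np; apply: contraL np => pX.
  by rewrite -leqNgt -prime_dvd_fact // -fE dvdn_mulr.
rewrite [leqRHS](big_cat_nat (n := m.+2)) //=; last by lia.
rewrite -[leqLHS]mul1n; apply: leq_mul.
  by apply: prodn_gt0 => -[|p]; rewrite ?expn_gt0 // logn0.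
rewrite big_mkcond /= !big_nat; apply: leq_prod => p /andP[mp pn].
case: ifP => pp; last by rewrite expn_gt0; apply/orP; left; lia.
rewrite -{1}[p]expn1 leq_exp2l ?prime_gt1 // -pfactor_dvdn // expn1.
have : p %| n`! by rewrite prime_dvd_fact //; lia.
by rewrite -fE !Euclid_dvdM // !prime_dvd_fact //; lia.
Qed.

Lemma expn4_le_central n : 4 ^ n <= n.*2.+1 * 'C(n.*2, n).
Proof.
have -> : 4 ^ n = (1 + 1) ^ n.*2 by rewrite -mul2n expnM.
have -> : n.*2.+1 * 'C(n.*2, n) = \sum_(i < n.*2.+1) 'C(n.*2, n).
  by rewrite sum_nat_const card_ord.
rewrite expnDn; apply: leq_sum => i _.
by rewrite !exp1n !muln1 bin_le_central.
Qed.

(** Legendre's formula; for n! the terms with k > n vanish, which lets both sums run to 2n. *)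
Lemma logn_central p n : prime p ->
  logn p 'C(n.*2, n) =
  \sum_(1 <= k < n.*2.+1) (n.*2 %/ p ^ k - 2 * (n %/ p ^ k)).
Proof.
move=> pp; have le_n : n <= n.*2 by lia.
rewrite sumnB => [|k _]; last first.
  by rewrite leq_divRL ?expn_gt0 ?prime_gt0 // -mulnA mul2n leq_double leq_trunc_div.
rewrite -logn_fact // -(bin_fact le_n) -addnn addnK addnn.
rewrite !lognM ?muln_gt0 ?fact_gt0 ?bin_gt0 // logn_fact //.
rewrite -big_distrr /= [X in 2 * X](big_cat_nat (n := n.+1)) //=.
rewrite [X in _ - 2 * (_ + X)]big1_seq; first by lia.
move=> k; rewrite mem_index_iota => /and3P[_ nk _].
rewrite divn_small //; apply: leq_trans nk _.
by apply/ltnW/ltn_expl/prime_gt1.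
Qed.

(** Each term of [logn_central] is at most 1, and it is 0 once p^k > 2n. *)
Lemma pfactor_central_le p n : prime p -> 0 < n ->
  p ^ logn p 'C(n.*2, n) <= n.*2.
Proof.
move=> pp n0; have p1 := prime_gt1 pp; set T := trunc_log p n.*2.
apply: (@leq_trans (p ^ T)); last by rewrite trunc_logP ?double_gt0.
rewrite leq_exp2l // logn_central //.
have lt_T k : T < k -> n.*2 < p ^ k.
  by move=> Tk; apply: leq_trans (trunc_log_ltn _ p1) _; rewrite leq_exp2l.
have le_T : T <= n.*2.
  have n20 : 0 < n.*2 by rewrite double_gt0.
  by apply: leq_trans (trunc_logP p1 n20); apply/ltnW/ltn_expl.
rewrite (big_cat_nat (n := T.+1)) //= [X in _ + X]big1_seq; last first.
  move=> k; rewrite mem_index_iota => /and3P[_ Tk _].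
  by rewrite (divn_small (lt_T _ Tk)).
rewrite addn0 -[leqRHS](subn1 T.+1) -[leqRHS]muln1 -sum_nat_const_nat.
apply: leq_sum => k _; have d0 : 0 < p ^ k by rewrite expn_gt0 ltnW.
rewrite leq_subLR -ltnS ltn_divLR // addn1.
have -> : (2 * (n %/ p ^ k)).+2 = (n %/ p ^ k).+1.*2 by lia.
by rewrite -doubleMl ltn_double ltn_ceil.
Qed.

(** Here 2n / p and n / p have integer parts 2 and 1, so the first term cancels; the higher powers
    of p exceed 2n. *)
Lemma logn_central0 p n : prime p -> n.*2 < 3 * p -> p <= n -> n.*2 < p ^ 2 ->
  logn p 'C(n.*2, n) = 0.
Proof.
move=> pp lt3 le_pn sq; rewrite logn_central // big1_seq // => k.
rewrite mem_index_iota => /and3P[_ k1 _].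
have p0 := prime_gt0 pp; case: k k1 => [|[|k]] // _; last first.
  rewrite (divn_small (leq_trans sq _)) //.
  by rewrite leq_exp2l // prime_gt1.
rewrite expn1; apply/eqP; rewrite subn_eq0.
have : 1 <= n %/ p by rewrite divn_gt0.
have : n.*2 %/ p < 3 by rewrite ltn_divLR.
lia.
Qed.

Lemma central_le n s : 0 < n -> n.*2 < s.+1 ^ 2 -> s <= n.*2 ->
  'C(n.*2, n) <= n.*2 ^ s.+1 * 4 ^ (n.*2 %/ 3) *
    n.*2 ^ (\sum_(0 <= p < n.*2.+1 | prime p && (n < p)) 1).
Proof.
move=> n0 lt_s le_s; have N0 : 0 < n.*2 by rewrite double_gt0.
have C0 : 0 < 'C(n.*2, n) by rewrite bin_gt0; lia.
have e1 : n.*2 ^ s.+1 = \prod_(0 <= p < n.*2.+1) (if p < s.+1 then n.*2 else 1).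
  rewrite -big_mkcond /= -(big_nat_widen 0 s.+1 n.*2.+1 predT) ?ltnS //.
  by rewrite prod_nat_const_nat subn0.
have e2 : \prod_(0 <= p < n.*2.+1) (if prime p && (p < (n.*2 %/ 3).+1) then p else 1)
    <= 4 ^ (n.*2 %/ 3).
  rewrite -big_mkcond /= -big_nat_widen; first exact: primorial_le.
  by rewrite ltnS leq_div.
have e3 : n.*2 ^ (\sum_(0 <= p < n.*2.+1 | prime p && (n < p)) 1) =
    \prod_(0 <= p < n.*2.+1) (if prime p && (n < p) then n.*2 else 1).
  by rewrite -big_mkcond /= expn_sum; apply: eq_bigr => p _; rewrite expn1.
rewrite {1}(@prod_logn _ n.*2 C0); last first.
  move=> p pp np; apply: contraL np => pC; rewrite -leqNgt -prime_dvd_fact //.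
  by rewrite -(@bin_fact n.*2 n) ?dvdn_mulr //; lia.
rewrite e1 e3.
apply: leq_trans (leq_mul (leq_mul (leqnn _) e2) (leqnn _)).
(* Each [p ^ logn p 'C(2n, n)] is bounded by the first factor for [p <= s], by
   the second for [s < p <= 2n/3] and by the third for [n < p]; it is [1] for
   the primes [p] in (2n/3, n]. *)
rewrite -!big_split /= !big_nat; apply: leq_prod => p /andP[_ le_p].
have [pp|np] /= := boolP (prime p); last first.
  by rewrite lognE (negPf np) expn0; case: ifP; lia.
have p0 := prime_gt0 pp; have p1 := prime_gt1 pp.
have v_le := pfactor_central_le pp n0.
case: ltnP => [_|lt_sp].
  rewrite -[leqLHS]muln1 -[leqLHS]muln1 !leq_mul //.
    by case: ifP.
  by case: ifP.
have sq : n.*2 < p ^ 2 by apply: leq_trans lt_s _; rewrite leq_exp2r.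
rewrite mul1n; case: (ltnP n p) => [lt_np|le_pn].
  rewrite -[leqLHS]mul1n leq_mul //; by case: ifP.
rewrite muln1; case: ltnP => [_|lt3].
  rewrite -[leqRHS]expn1 leq_exp2l // -ltnS -(ltn_exp2l _ _ p1).
  exact: leq_ltn_trans sq.
rewrite logn_central0 // mulnC.
by rewrite -ltn_divLR.
Qed.

Lemma sqrn_le_expn2 n : 4 <= n -> n ^ 2 <= 2 ^ n.
Proof.
elim: n => // n IH; rewrite leq_eqVlt => /orP[/eqP <- //|n4].
rewrite (expnS 2 n); have := IH n4; rewrite -!mulnn; nia.
Qed.

(** With n = 2^k large, fewer than m primes in (n, 2n] would make the bound of [central_le], whose
    main factor is 4^(2n/3), smaller than 4^n / (2n + 1). *)
Lemma many_primes m : exists k0, forall k, k0 <= k ->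
  m <= \sum_(0 <= p < (2 ^ k.+1).+1 | prime p && (2 ^ k < p)) 1.
Proof.
(* The estimates below end in y^2 <= 2^y <= 9(m + 5)y for y = (k + 1)/2 rounded down; this choice
   forces y > 9(m + 5). *)
exists (2 * (9 * (m + 5) + 5)) => k le_k; rewrite leqNgt; apply/negP.
have N2 : 2 ^ k.+1 = (2 ^ k).*2 by rewrite expnS mul2n.
rewrite N2; set c := \sum_(_ <= _ < _ | _) 1 => lt_cm.
set y := k.+1./2; have y9 : 9 * (m + 5) + 4 < y by rewrite /y; lia.
have n0 : 0 < 2 ^ k by rewrite expn_gt0.
have lt_s : (2 ^ k).*2 < (2 ^ y.+1).+1 ^ 2.
  apply: (@leq_ltn_trans ((2 ^ y.+1) ^ 2)); last by rewrite ltn_exp2r.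
  by rewrite -N2 -expnM leq_exp2l // /y; lia.
have le_s : 2 ^ y.+1 <= (2 ^ k).*2 by rewrite -N2 leq_exp2l // /y; lia.
have := leq_mul (leqnn (2 ^ k).*2.+1) (central_le n0 lt_s le_s).
move=> /(leq_trans (expn4_le_central _)); rewrite -/c -N2.
move=> /leq_trans /(_ (leq_mul (n1 := 2 ^ k.+2) _ (leqnn _))) h.
have {h} := h _; rewrite -[4]/(2 ^ 2) -!expnM -!expnD => h.
(* Comparison of the exponents of 2, the factor 2n + 1 being bounded by 2^(k + 2). *)
have {h} : 2 * 2 ^ k <= k.+2 + (k.+1 * (2 ^ y.+1).+1 + 2 * (2 ^ k.+1 %/ 3) + k.+1 * c).
  rewrite -(leq_exp2l (m := 2)) //; apply: h.
  have : 0 < 2 ^ k.+1 by rewrite expn_gt0. 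
  by rewrite (expnS 2 k.+1); lia.
rewrite -expnS; set x := 2 ^ y.
have -> : 2 ^ y.+1 = 2 * x by rewrite expnS.
have xx : x * x <= 2 ^ k.+1 by rewrite -expnD leq_exp2l // /y; lia.
have yy : y * y <= x by rewrite mulnn sqrn_le_expn2; lia.
set N := 2 ^ k.+1 in xx * => h.
have h1 : N <= 3 * k.+1 * (2 * x + m + 3).
  have : 3 * (N %/ 3) <= N by rewrite mulnC leq_trunc_div.
  have : k.+1 * c <= k.+1 * m by rewrite leq_mul2l ltnW.
  move: (N %/ 3) h => z; nia.
have h2 : 3 * k.+1 * (2 * x + m + 3) <= 9 * y * ((m + 5) * x).
  apply: leq_mul; first by rewrite /y; lia.
  have x0 : 0 < x by rewrite expn_gt0.
  by have := leq_pmulr m x0; rewrite mulnDl; lia.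
have h3 : x <= 9 * y * (m + 5).
  rewrite -(leq_pmul2r (m := x)) ?expn_gt0 // -mulnA.
  exact: leq_trans xx (leq_trans h1 h2).
have : y * y <= 9 * (m + 5) * y by apply: leq_trans yy _; rewrite mulnAC.
by rewrite leq_pmul2r; lia.
Qed.

Local Open Scope ring_scope.

(** * Factors of polynomials with coefficients 1 and -1 *)

Lemma intr_F2_sign (x : int) : `|x| = 1 -> x%:~R = 1 :> 'F_2.
Proof.
move=> x1; have [h|h] : x = 1 \/ x = -1 by lia.
  by rewrite h.
by rewrite h; apply/val_inj.
Qed.

Lemma intr_F2_eq0 (x : int) : (x%:~R == 0 :> 'F_2) = (2 %| x)%Z.
Proof. by rewrite (dvdz_pcharf (pchar_Fp (isT : prime 2))). Qed.

Lemma coef_X1_exp (R : comNzRingType) (n j : nat) :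
  (('X + 1 : {poly R}) ^+ n)`_j = 'C(n, j)%:R.
Proof.
rewrite exprD1n -(big_mkord xpredT (fun l => 'X^l *+ 'C(n, l))) coef_sum.
have [le_jn|lt_nj] := leqP j n; last first.
  rewrite bin_small // big1_seq // => l; rewrite mem_index_iota => /andP[_ lt_ln].
  by rewrite coefMn coefXn; case: eqP => [e|_]; [lia|rewrite mul0rn].
rewrite (bigD1_seq j) ?iota_uniq ?mem_index_iota //= coefMn coefXn eqxx.
rewrite big1 ?addr0 // => l /negPf lj.
by rewrite coefMn coefXn eq_sym lj mul0rn.
Qed.

Lemma coef_shift (R : comNzRingType) (n : nat) (u : nat -> R) (j : nat) :
  ((\poly_(i < n) u i) \Po ('X + 1))`_j = \sum_(i < n) u i *+ 'C(i, j).
Proof.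
rewrite poly_def raddf_sum /= coef_sum; apply: eq_bigr => i _.
by rewrite comp_polyZ comp_Xn_poly coefZ coef_X1_exp mulr_natr.
Qed.

Lemma size_sign_poly (k : nat) (u : nat -> int)
    (u_sign : forall i, (i < 2 ^ k)%N -> `|u i| = 1) :
  size (\poly_(i < 2 ^ k) u i) = (2 ^ k)%N.
Proof.
have N0 : (0 < 2 ^ k)%N by rewrite expn_gt0.
apply: size_poly_eq; rewrite -normr_eq0 u_sign ?oner_eq0 //.
by rewrite prednK.
Qed.

(* [X * P(X + 1) = (X + 1) ^ N - 1 = X ^ N] over F_2. *)
Lemma shift_mod2 (k : nat) (u : nat -> int)
    (u_sign : forall i, (i < 2 ^ k)%N -> `|u i| = 1) :
  map_poly (intr : int -> 'F_2) ((\poly_(i < 2 ^ k) u i) \Po ('X + 1)) = 'X^((2 ^ k).-1).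
Proof.
have N0 : (0 < 2 ^ k)%N by rewrite expn_gt0.
rewrite map_comp_poly rmorphD /= map_polyX rmorph1.
have -> : map_poly intr (\poly_(i < 2 ^ k) u i) = \sum_(i < 2 ^ k) 'X^i :> {poly 'F_2}.
  apply/polyP => i; rewrite coef_map coef_poly /= coef_sum.
  rewrite -(big_mkord xpredT (fun l => ('X^l : {poly 'F_2})`_i)).
  case: ltnP => le_i.
    rewrite (bigD1_seq i) ?iota_uniq ?mem_index_iota //= coefXn eqxx.
    rewrite big1 ?addr0 ?intr_F2_sign ?u_sign // => l /negPf li.
    by rewrite coefXn eq_sym li.
  rewrite big1_seq // => l; rewrite mem_index_iota => /andP[_ lt_l].
  by rewrite coefXn; case: eqP => // e; lia.
rewrite raddf_sum /=; under eq_bigr do rewrite comp_Xn_poly.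
have X0 : 'X != 0 :> {poly 'F_2} by rewrite polyX_eq0.
apply: (mulfI X0); rewrite -exprS prednK //.
have := subrX1 ('X + 1 : {poly 'F_2}) (2 ^ k); rewrite addrK => <-.
rewrite exprDn_pchar ?expr1n ?addrK //.
by rewrite pnatX pnatE // pchar_poly pchar_Fp.
Qed.

(** Over F_2 the shifted factor divides a power of X, hence is a scalar times a power of X. Its
    degree survives reduction because the leading coefficient of [G] divides 1 or -1 and so is
    odd. *)
Lemma factor_coef_even (k : nat) (u : nat -> int)
    (u_sign : forall i, (i < 2 ^ k)%N -> `|u i| = 1) (G H : {poly int}) (i : nat) :
  (\poly_(i < 2 ^ k) u i) = G * H -> (i < (size G).-1)%N -> (2 %| (G \Po ('X + 1))`_i)%Z.
Proof.
move=> PGH lt_i; have := shift_mod2 u_sign; rewrite PGH comp_polyM rmorphM /=.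
set G' := map_poly _ (G \Po _); set H' := map_poly _ (H \Po _) => GH.
have size_X1 : size ('X + 1 : {poly int}) = 2%N by rewrite size_XaddC.
have GH0 : G' * H' != 0 by rewrite GH -size_poly_eq0 size_polyXn.
have dvdG : G' %| ('X - 0%:P) ^+ ((2 ^ k).-1) by rewrite subr0 -GH dvdp_mulr.
have /dvdp_exp_XsubCP[a _ /eqpf_eq[c c0]] := dvdG; rewrite subr0 => Ga.
have size_G : size G' = size G.
  rewrite size_map_poly_id0 ?size_comp_poly2 //.
  rewrite lead_coef_comp ?size_X1 // lead_coefXaddC expr1n mulr1 intr_F2_eq0.
  have lcP : `|lead_coef (\poly_(i < 2 ^ k) u i)| = 1.
    rewrite lead_coefE size_sign_poly // coef_poly ltn_predL expn_gt0 u_sign //.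
    by rewrite ltn_predL expn_gt0.
  apply/negP => /dvdzP[x lcG].
  move: lcP; rewrite PGH lead_coefM lcG -mulrA mulrCA; lia.
rewrite -intr_F2_eq0 -coef_map -/G' Ga coefZ coefXn.
have : (size G').-1 = a by rewrite Ga size_scale // size_polyXn.
by rewrite size_G => <-; rewrite (ltn_eqF lt_i) mulr0.
Qed.

(** If j is below both degrees, every term of the convolution giving the j-th coefficient is a
    product of two even numbers. *)
Lemma small_factor_degree (k : nat) (u : nat -> int)
    (u_sign : forall i, (i < 2 ^ k)%N -> `|u i| = 1) (G H : {poly int}) (j : nat) :
  (\poly_(i < 2 ^ k) u i) = G * H ->
  ~~ (4 %| ((\poly_(i < 2 ^ k) u i) \Po ('X + 1))`_j)%Z ->
  ((size G).-1 <= j)%N \/ ((size H).-1 <= j)%N.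
Proof.
move=> PGH; have PHG := etrans PGH (mulrC G H).
case: (leqP (size G).-1 j) => [|lt_G]; first by left.
case: (leqP (size H).-1 j) => [|lt_H]; first by right.
case/negP; rewrite PGH comp_polyM coefM; apply: (big_ind (fun x => (4 %| x)%Z)) => //.
  by move=> x y; apply: rpredD.
move=> i _; rewrite (_ : 4 = 2 * 2) // dvdz_mul //.
  by apply: (factor_coef_even u_sign PGH); apply: leq_ltn_trans lt_G; rewrite -ltnS.
by apply: (factor_coef_even u_sign PHG); apply: leq_ltn_trans lt_H; rewrite leq_subr.
Qed.

Lemma geometric_sum_lt (F : numFieldType) (x : F) (n : nat) :
  2 <= x -> \sum_(i < n) x ^+ i < x ^+ n.
Proof.
move=> x2; have x0 : 0 < x by apply: lt_le_trans x2.
elim: n => [|n IH]; first by rewrite big_ord0.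
rewrite big_ord_recr /= exprS; apply: lt_le_trans (_ : 2 * x ^+ n <= _).
  by rewrite mulr_natl mulr2n ltrD2r.
by rewrite ler_pM2r ?exprn_gt0.
Qed.

(** For |z| > 2 the leading term outweighs the sum of all the others. *)
Lemma sign_poly_root_le2 (F : numFieldType) (n : nat) (p : {poly F}) (z : F) :
  size p = n.+1 -> (forall i, (i <= n)%N -> `|p`_i| = 1) -> root p z -> `|z| <= 2.
Proof.
move=> sp sgn /rootP; rewrite horner_coef sp big_ord_recr /= => /eqP.
rewrite addrC addr_eq0 => /eqP h.
rewrite real_leNgt ?normr_real ?realn //; apply/negP => z2.
have := geometric_sum_lt n (ltW z2); rewrite -normrX -[X in _ < X]mul1r.
rewrite -(sgn n (leqnn n)) -normrM h normrN; apply/negP.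
rewrite -real_leNgt ?normr_real ?rpred_sum // => [|i _]; last first.
  by rewrite rpredX ?normr_real.
apply: le_trans (ler_norm_sum _ _ _) _; apply: ler_sum => i _.
by rewrite normrM sgn ?mul1r ?normrX // ltnW.
Qed.

(** Multiplication by X - z with |z| <= 2 enlarges a bound on the coefficients by a factor of at
    most 1 + 2. *)
Lemma coef_prod_XsubC_le (F : numFieldType) (s : seq F) (i : nat) :
  (forall z, z \in s -> `|z| <= 2) ->
  `|(\prod_(z <- s) ('X - z%:P))`_i| <= 3 ^+ size s.
Proof.
elim: s i => [|z s IH] i s2.
  by rewrite big_nil coef1; case: (i == 0)%N; rewrite ?normr1 ?normr0.
have {}IH l := IH l (fun y ys => s2 y (@mem_behead _ (z :: s) y ys)).
rewrite big_cons mulrBl coefB coefXM coefCM exprS.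
have -> : 3 * 3 ^+ size s = 3 ^+ size s + 2 * 3 ^+ size s :> F by ring.
apply: le_trans (ler_normB _ _) (lerD _ _).
  by case: (i == 0)%N; rewrite ?normr0 ?exprn_ge0 ?IH.
by rewrite normrM ler_pM // s2 ?mem_head.
Qed.

(** The leading coefficient of [g] is 1 or -1, and its complex roots are among those of the product,
    hence of modulus at most 2. As the bound does not involve n, each degree has finitely many
    candidates. *)
Lemma factor_coef_le (g r : {poly int}) (n : nat) :
  size (g * r) = n.+1 -> (forall i, (i <= n)%N -> `|(g * r)`_i| = 1) ->
  forall i, `|g`_i| <= 3 ^+ (size g).-1.
Proof.
move=> sp sgn i.
have gr0 : g * r != 0 by rewrite -size_poly_eq0 sp.
have [g0 r0] : g != 0 /\ r != 0 by move: gr0; rewrite mulf_eq0 negb_or => /andP.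
have lcg : `|lead_coef g| = 1.
  have := sgn n (leqnn n); rewrite -[n]/(n.+1.-1) -sp -lead_coefE lead_coefM.
  rewrite normrM; have : `|lead_coef g| != 0 by rewrite normr_eq0 lead_coef_eq0.
  have : `|lead_coef r| != 0 by rewrite normr_eq0 lead_coef_eq0.
  have := normr_ge0 (lead_coef g); have := normr_ge0 (lead_coef r).
  move: `|lead_coef g| `|lead_coef r| => x y y0 x0 yn0 xn0 xy; nia.
pose toC := map_poly (intr : int -> algC).
have inj : injective (intr : int -> algC) by apply: intr_inj.
have [s gE] := closed_field_poly_normal (toC g).
have lcE : lead_coef (toC g) = (lead_coef g)%:~R by rewrite lead_coef_map_inj.
have sizes : size s = (size g).-1.
  have := size_map_inj_poly inj (rmorph0 _) g; rewrite -/(toC g) gE size_scale.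
    by rewrite size_prod_XsubC => <-.
  by rewrite lcE intr_eq0 lead_coef_eq0.
have le : `|(toC g)`_i| <= 3 ^+ (size g).-1.
  rewrite gE coefZ normrM lcE -intr_norm lcg mul1r -sizes.
  apply: coef_prod_XsubC_le => z zs.
  apply: (@sign_poly_root_le2 _ n (toC (g * r))).
  - by rewrite /toC size_map_inj_poly.
  - by move=> l ln; rewrite coef_map /= -intr_norm sgn.
  - rewrite /toC rmorphM /= rootM -/(toC g) gE rootZ ?root_prod_XsubC ?zs //.
    by rewrite lcE intr_eq0 lead_coef_eq0.
by move: le; rewrite coef_map /= -intr_norm -(ler_int algC) rmorphXn.
Qed.

(** Gauss's lemma turns a rational factor into an integral one, and one of the two cofactors has
    degree at most j. So only factors from a finite set remain to be excluded. *)
Lemma irreducible_sign_poly (k : nat) (u : nat -> int) (j : nat) :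
  (0 < k)%N -> (forall i, (i < 2 ^ k)%N -> `|u i| = 1) ->
  let P := \poly_(i < 2 ^ k) u i in
  ~~ (4 %| (P \Po ('X + 1))`_j)%Z ->
  (forall g r : {poly int}, P = g * r -> (1 < size g)%N ->
     ((size g).-1 <= j)%N -> (forall i, `|g`_i| <= 3 ^+ j) -> False) ->
  irreducible_poly (map_poly (intr : int -> rat) P).
Proof.
move=> k0 u1 P c4 noF.
have N1 : (1 < 2 ^ k)%N by rewrite -(expn0 2) ltn_exp2l.
have sP : size P = (2 ^ k)%N by apply: size_sign_poly.
have sN : size P = ((2 ^ k).-1).+1 by rewrite sP (prednK (ltnW N1)).
have no_factor g r : P = g * r -> (1 < size g)%N -> ((size g).-1 <= j)%N -> False.
  move=> PE g1 gj; apply: (noF _ _ PE g1 gj) => i.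
  rewrite PE in sN; apply: le_trans (factor_coef_le sN _ _) _.
    move=> l ll; rewrite -PE coef_poly ifT ?u1 //; move: ll N1; lia.
  by rewrite ler_weXn2l.
have injQ : injective (intr : int -> rat) by apply: intr_inj.
have sPQ : size (map_poly (intr : int -> rat) P) = size P by rewrite size_map_inj_poly.
split=> [|q q1 qP]; first by rewrite sPQ sP.
have [g [a a0 qE] [r PE]] := dvdpP_rat_int qP.
have sq : size q = size g by rewrite qE size_scale // size_map_inj_poly.
rewrite -dvdp_size_eqp // sPQ sq; apply/negPn/negP => ne.
have P0 : P != 0 by rewrite -size_poly_eq0 sN.
have [g0 r0] : g != 0 /\ r != 0 by move: P0; rewrite PE mulf_eq0 negb_or => /andP.
have g1 : (1 < size g)%N by move: q1; rewrite sq; move: (g0); rewrite -size_poly_eq0; lia.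
have r1 : (1 < size r)%N.
  move: ne (r0); rewrite PE size_mul // -size_poly_eq0.
  by case: (size r) => [|[|m]] //; rewrite addn1 eqxx.
have [gj|rj] := small_factor_degree u1 PE c4.
  exact: (no_factor g r).
by apply: (no_factor r g) => //; rewrite mulrC.
Qed.

(** * Multiplicative coefficients and the signs of the primes *)

Lemma partial_sum_polyE (f : nat -> int) (N : nat) :
  partial_sum_poly f N =
  \poly_(i < N) completely_multiplicative_extension f i.+1.
Proof.
rewrite /partial_sum_poly big_add1 /= big_mkord poly_def.
by apply: eq_bigr => i _; rewrite mul_polyC.
Qed.

Lemma eq_multiplicative_extension (f g : nat -> int) (n : nat) :
  (forall p, p \in primes n -> f p = g p) ->
  completely_multiplicative_extension f n =
  completely_multiplicative_extension g n.
Proof. by move=> fg; apply: eq_big_seq => p /fg ->. Qed.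

Lemma multiplicative_extension_sign (f : nat -> int) (n : nat) :
  (forall p, `|f p| = 1) -> `|completely_multiplicative_extension f n| = 1.
Proof.
move=> f1; rewrite normr_prod big1 // => p _.
by rewrite normrX f1 expr1n.
Qed.

Definition primes_upto (N : nat) := {p : 'I_N.+1 | prime p}.

Definition prime_val (N : nat) (i : primes_upto N) : nat := val (val i).
Coercion prime_val : primes_upto >-> nat.

Lemma prime_valP (N : nat) (i : primes_upto N) : prime i.
Proof. exact: (valP i). Qed.

Lemma prime_val_inj (N : nat) : injective (@prime_val N).
Proof. by move=> i j /val_inj /val_inj. Qed.

(* [A] is the set of primes at which the random function takes the value -1. *)
Definition sign_of (N : nat) (A : {set primes_upto N}) (p : nat) : int :=
  (-1) ^+ [exists i in A, prime_val i == p].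

Lemma sign_of_val (N : nat) (A : {set primes_upto N}) (i : primes_upto N) :
  sign_of A i = (-1) ^+ (i \in A).
Proof.
congr (_ ^+ nat_of_bool _); apply/exists_inP/idP => [[j jA /eqP /prime_val_inj <-] //|iA].
by exists i.
Qed.

Lemma sign_of_norm (N : nat) (A : {set primes_upto N}) (p : nat) :
  `|sign_of A p| = 1.
Proof. by rewrite /sign_of normrX normrN1 expr1n. Qed.

Lemma sign_of_flip (N : nat) (A : {set primes_upto N}) (a : primes_upto N) (p : nat) :
  sign_of (flip a A) p = (if p == a then -1 else 1) * sign_of A p.
Proof.
have [/existsP[i /eqP <-]|no] := boolP [exists i : primes_upto N, prime_val i == p].
  rewrite !sign_of_val (inj_eq (@prime_val_inj N)) inE signr_addb mulrC.
  by case: (i == a).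
have pa : (p == a) = false.
  by apply: contraNF no => /eqP ->; apply/existsP; exists a.
rewrite pa mul1r; congr (_ ^+ nat_of_bool _).
transitivity false; [|symmetry]; apply: contraNF no => /exists_inP[i _ ip];
  by apply/existsP; exists i.
Qed.

Definition random_coef (N : nat) (A : {set primes_upto N}) (n : nat) : int :=
  completely_multiplicative_extension (sign_of A) n.

Lemma random_coef_sign N (A : {set primes_upto N}) n : `|random_coef A n| = 1.
Proof. exact/multiplicative_extension_sign/sign_of_norm. Qed.

Lemma random_coef_flip N (A : {set primes_upto N}) (a : primes_upto N) n :
  random_coef (flip a A) n = (-1) ^+ logn a n * random_coef A n.
Proof.
rewrite /random_coef /completely_multiplicative_extension.
under eq_bigr do rewrite sign_of_flip exprMn.
rewrite big_split /=; congr (_ * _).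
have [an|an] := boolP (prime_val a \in primes n).
  rewrite (bigD1_seq _ an (primes_uniq n)) /= eqxx big1 ?mulr1 // => p /negPf ->.
  by rewrite expr1n.
rewrite big1_seq => [|p /andP[_ pn]].
  by rewrite -logn_gt0 lt0n negbK in an; rewrite (eqP an).
by case: eqP pn an => [-> ->|_ _ _]; rewrite ?expr1n.
Qed.

Lemma logn_large (p n N : nat) : prime p -> (0 < n <= N)%N -> (N < p ^ 2)%N ->
  logn p n = (p %| n)%N.
Proof.
move=> pp /andP[n0 nN] lt_N; have lt2 : (logn p n < 2)%N.
  by rewrite ltnNge -pfactor_dvdn //; apply/negP => /(dvdn_leq n0); lia.
have := pfactor_dvdn 1 pp n0; rewrite expn1 => ->; lia.
Qed.

Lemma random_coef_flip_large N (A : {set primes_upto N}) (a : primes_upto N) n :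
  (N < a ^ 2)%N -> (0 < n <= N)%N ->
  random_coef (flip a A) n =
  random_coef A n - (if (a %| n)%N then 2 * random_coef A n else 0).
Proof.
move=> lt_N nN; rewrite random_coef_flip (logn_large (prime_valP a) nN lt_N).
by case: (a %| n)%N; rewrite /= ?expr1 ?expr0; ring.
Qed.

(** * Effect of flipping a prime on the coefficients of P(X + 1) *)

Local Open Scope nat_scope.

(** From (i + 1) 'C(i, 2^t - 1) = 2^t 'C(i + 1, 2^t), an odd number being coprime to 2^t. *)
Lemma odd_bin_dvdn (t i : nat) : odd 'C(i, (2 ^ t).-1) -> 2 ^ t %| i.+1.
Proof.
move=> odd_c; have := mul_bin_diag i.+1 (2 ^ t).-1.
rewrite prednK ?expn_gt0 //= => e.
by rewrite -(@Gauss_dvdl _ _ 'C(i, (2 ^ t).-1)) ?coprimeXl ?coprime2n // e dvdn_mulr.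
Qed.

(** Over F_2, (X + 1)^(2^t m) = (X^(2^t) + 1)^m, so 'C(2^t m, 2^t) has the parity of m; it equals m
    'C(2^t m - 1, 2^t - 1). *)
Lemma odd_bin_expn2_mul (t m : nat) :
  odd m -> odd 'C((2 ^ t * m).-1, (2 ^ t).-1).
Proof.
move=> odd_m; have m0 := odd_gt0 odd_m.
have N0 : 0 < 2 ^ t by rewrite expn_gt0.
have odd_C : odd 'C(2 ^ t * m, 2 ^ t).
  have e : (('X + 1 : {poly 'F_2}) ^+ (2 ^ t * m))%R =
           (\sum_(i < m.+1) 'X^(2 ^ t * i) *+ 'C(m, i))%R.
    rewrite exprM exprDn_pchar ?pnatX ?pnatE ?pchar_poly ?pchar_Fp //.
    by rewrite expr1n exprD1n; apply: eq_bigr => i _; rewrite exprM.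
  have := congr1 (fun q : {poly 'F_2} => (q`_(2 ^ t))%R) e.
  rewrite coef_X1_exp coef_sum (bigD1 (Ordinal (m0 : 1 < m.+1))) //=.
  rewrite muln1 bin1 coefMn coefXn eqxx big1 ?addr0 => [|i i1]; last first.
    rewrite coefMn coefXn -{1}[2 ^ t]muln1 eqn_pmul2l // eq_sym.
    by rewrite -(inj_eq val_inj) /= in i1; rewrite (negPf i1) mul0rn.
  have nat2 n : ((n%:R : 'F_2) == 0)%R = ~~ odd n.
    by rewrite -dvdn2 (dvdn_pcharf (pchar_Fp (isT : prime 2))).
  move/eqP; rewrite -subr_eq0 -[odd _]negbK -nat2 => /eqP /subr0_eq ->.
  by rewrite nat2 odd_m.
have := mul_bin_diag (2 ^ t * m) (2 ^ t).-1; rewrite prednK //.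
rewrite -mulnA => /eqP; rewrite eqn_pmul2l // => /eqP e.
by move: odd_C; rewrite -e oddM => /andP[].
Qed.

Lemma many_prime_ords m : exists k0, forall k, k0 <= k ->
  m <= #|[set a : primes_upto (2 ^ k.+1) | 2 ^ k < prime_val a]|.
Proof.
have [k0 km] := many_primes m; exists k0 => k /km /leq_trans; apply.
rewrite big_mkord -sum1_card (reindex_omap (J := primes_upto (2 ^ k.+1)) val insub) /=.
  by apply/eq_leq/eq_bigl => a; rewrite valK eqxx andbT (valP a) inE.
by move=> i /andP[pi _]; rewrite insubT.
Qed.

Local Open Scope ring_scope.

Definition shift_coef (k : nat) (A : {set primes_upto (2 ^ k)}) (t : nat) : int :=
  (partial_sum_poly (sign_of A) (2 ^ k) \Po ('X + 1))`_(2 ^ t).-1.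

(** As a^2 > 2^k, a divides each n <= 2^k at most once, so exactly the coefficients at multiples of
    a change sign. *)
Lemma shift_coef_flip k (A : {set primes_upto (2 ^ k)}) (a : primes_upto (2 ^ k)) t :
  (2 ^ k < a ^ 2)%N ->
  shift_coef (flip a A) t = shift_coef A t -
    2 * \sum_(i < 2 ^ k | (a %| i.+1)%N)
           random_coef A i.+1 *+ 'C(i, (2 ^ t).-1).
Proof.
move=> lt_a; rewrite /shift_coef !partial_sum_polyE !coef_shift.
rewrite big_distrr /= [X in _ - X]big_mkcond -sumrB /=; apply: eq_bigr => i _.
rewrite -!/(random_coef _ _) random_coef_flip_large ?ltn_ord //.
by case: ifP => _; rewrite ?subr0 // mulrnBl mulrnAr.
Qed.

Lemma random_coef_bin_even k (A : {set primes_upto (2 ^ k)}) (n i t : nat) :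
  ~~ odd 'C(i, (2 ^ t).-1) -> (2 %| random_coef A n *+ 'C(i, (2 ^ t).-1))%Z.
Proof.
rewrite -dvdn2 => /dvdnP[m ->]; rewrite mulrnA -[_ *+ 2]mulr_natr.
by rewrite dvdz_mull.
Qed.

Section Dyadic.
Variables (k s t : nat) (a : primes_upto (2 ^ k)).
Hypotheses (lt_s : (s.*2.+2 < k)%N) (lo : (2 ^ (k - s.+1) < a)%N)
  (hi : (a <= 2 ^ (k - s))%N).

Let odd_a : odd a.
Proof.
have := prime_valP a; have := even_prime (prime_valP a).
case=> // a2; move: lo; rewrite a2 -{2}[2%N]expn1 ltn_exp2l //; lia.
Qed.

Let sqr_a : (2 ^ k < a ^ 2)%N.
Proof.
apply: (@leq_ltn_trans ((2 ^ (k - s.+1)) ^ 2)).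
  by rewrite -expnM leq_exp2l //; lia.
by rewrite ltn_exp2r.
Qed.

Let dvd_large i : (a %| i.+1)%N -> odd 'C(i, (2 ^ t).-1) -> (2 ^ t * a %| i.+1)%N.
Proof.
move=> ai /odd_bin_dvdn ti.
by rewrite Gauss_dvd ?ai ?ti // coprimeXl // coprime2n.
Qed.

(** An odd binomial in the sum would require 2^t a to divide some i + 1 <= 2^k, but 2^t a > 2^k when
    s < t. *)
Lemma shift_coef_flip_lt A : (s < t)%N ->
  (4 %| shift_coef (flip a A) t - shift_coef A t)%Z.
Proof.
move=> st; rewrite shift_coef_flip // addrAC subrr sub0r rpredN.
rewrite (_ : 4 = 2 * 2) // dvdz_mul //.
apply: (big_ind (fun x => (2 %| x)%Z)) => // [x y|i ai]; first exact: rpredD.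
apply: random_coef_bin_even; apply/negP => /(dvd_large ai) /(dvdn_leq (ltn0Sn i)).
apply/negP; rewrite -ltnNge; apply: leq_ltn_trans (ltn_ord i) _.
apply: (@leq_ltn_trans (2 ^ t * 2 ^ (k - s.+1))).
  by rewrite -expnD leq_exp2l //; lia.
by rewrite ltn_pmul2l ?expn_gt0.
Qed.

(** Now 2^t a <= 2^k < 2 (2^t a), so the only odd term of the sum is the one at n = 2^t a, and twice
    the sum is 2 modulo 4. *)
Lemma shift_coef_flip_eq A : s = t ->
  (4 %| shift_coef (flip a A) t - shift_coef A t - 2)%Z.
Proof.
move=> st; have a0 := prime_gt0 (prime_valP a).
have le_ta : (2 ^ t * a <= 2 ^ k)%N.
  apply: leq_trans (leq_mul (leqnn _) hi) _.
  by rewrite -expnD leq_exp2l //; lia.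
have ta0 : (0 < 2 ^ t * a)%N by rewrite muln_gt0 expn_gt0.
have lt_ta : ((2 ^ t * a).-1 < 2 ^ k)%N by rewrite prednK.
rewrite shift_coef_flip // (bigD1 (Ordinal lt_ta)) /= ?prednK ?dvdn_mull //.
set x := random_coef A _ *+ _; set y := \sum_(_ < _ | _) _.
have x2 : ~~ (2 %| x)%Z.
  have := odd_bin_expn2_mul t odd_a; have := random_coef_sign A (2 ^ t * a).
  rewrite /x -mulr_natr; set c := 'C(_, _); set z := random_coef _ _ => z1 odd_c.
  have [->|->] : z = 1 \/ z = -1 by lia.
    by apply/negP => /dvdzP[w]; lia.
  by apply/negP => /dvdzP[w]; lia.
have y2 : (2 %| y)%Z.
  apply: (big_ind (fun x => (2 %| x)%Z)) => // [u v|i /andP[ai ne]]; first exact: rpredD.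
  apply: random_coef_bin_even; apply: contraNN ne => /(dvd_large ai) /dvdnP[m e].
  have := ltn_ord i; rewrite -(inj_eq val_inj) /=.
  have lt_2 : (2 ^ k < 2 * (2 ^ t * a))%N.
    apply: (@leq_ltn_trans (2 * (2 ^ t * 2 ^ (k - s.+1)))).
      by rewrite -expnD -expnS leq_exp2l //; lia.
    by rewrite !ltn_pmul2l ?expn_gt0.
  have unique (m' w l N : nat) :
      (l.+1 = m' * w -> N < 2 * w -> l < N -> l = w.-1)%N.
    by case: m' => [|[|m']]; rewrite ?mulSn; lia.
  by move=> lt_i; rewrite (unique _ _ _ _ e lt_2 lt_i).
by apply/dvdzP; case/dvdzP: y2 => y' ->; exists (- ((x + 1) %/ 2)%Z - y'); lia.
Qed.

End Dyadic.

Lemma incompatible_mod4 (x y w : int) :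
  (4 %| x)%Z -> (4 %| y)%Z -> (4 %| (x - w)%R)%Z -> (4 %| (y - w - 2)%R)%Z -> False.
Proof. by move=> /dvdzP[a ->] /dvdzP[b ->] /dvdzP[c +] /dvdzP[d +]; lia. Qed.

Local Open Scope nat_scope.

(** Take one prime p_t from each dyadic interval. At most one of them flips a given pattern into the
    set: if p_s and p_t with s < t both did, [shift_coef] at t would differ by 2 modulo 4 between
    two patterns where 4 divides it. Then [flip_count] applies. *)
Lemma small_shift_coefs_count r : exists k0, forall k, k0 <= k ->
  #|[set A : {set primes_upto (2 ^ k)} |
      [forall t : 'I_r, (4 %| shift_coef A t)%Z]]| * r
    <= 2 ^ #|{: primes_upto (2 ^ k)}|.
Proof.
(* This gives 2t + 2 < k and k - t - 1 >= k0 for all t < r. *)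
have [k0 kP] := many_prime_ords 1; exists (k0 + r.*2 + 3) => k le_k.
have dyadic (t : 'I_r) : exists a : primes_upto (2 ^ k),
    (2 ^ (k - t.+1) < prime_val a) && (prime_val a <= 2 ^ (k - t)).
  have lt_t := ltn_ord t; have := kP (k - t.+1) ltac:(lia).
  rewrite subnSK; last by lia.
  case/card_gt0P => -[i pi]; rewrite inE /= => lo.
  have ik : i < (2 ^ k).+1.
    by apply: leq_trans (ltn_ord i) _; rewrite ltnS leq_exp2l // leq_subr.
  exists (exist _ (Ordinal ik) pi); rewrite /prime_val /= lo.
  by rewrite -ltnS; apply: ltn_ord.
have lt_k (t : 'I_r) : t.*2.+2 < k by have := ltn_ord t; lia.
pose p (t : 'I_r) : primes_upto (2 ^ k) := xchoose (dyadic t).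
have lo (t : 'I_r) : 2 ^ (k - t.+1) < prime_val (p t).
  by have /andP[] := xchooseP (dyadic t).
have hi (t : 'I_r) : prime_val (p t) <= 2 ^ (k - t).
  by have /andP[] := xchooseP (dyadic t).
have lt_p (s t : 'I_r) : s < t -> prime_val (p t) < prime_val (p s).
  move=> st; apply: leq_ltn_trans (hi t) (leq_ltn_trans _ (lo s)).
  by rewrite leq_exp2l //; lia.
have p_inj : injective p.
  move=> s t e; apply/val_inj; case: (ltngtP s t) => // /lt_p; rewrite e; lia.
set E := [set A | _].
have -> : r = #|[set p t | t in 'I_r]| by rewrite card_imset ?card_ord.
rewrite -[leqRHS]mul1n; apply: flip_count => B.
apply/card_le1_eqP => a b; rewrite !inE.
have no (s t : 'I_r) : s < t -> flip (p s) B \in E -> flip (p t) B \in E -> False.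
  move=> st; rewrite !inE => /forallP /(_ t) Es /forallP /(_ t) Et.
  have h1 := shift_coef_flip_lt (lt_k s) (lo s) (hi s) B st.
  have h2 := shift_coef_flip_eq (lt_k t) (lo t) (hi t) B erefl.
  exact: (incompatible_mod4 Es Et h1 h2).
case/andP=> /imsetP[s _ ->] Es /andP[/imsetP[t _ ->] Et].
case: (ltngtP s t) => [st|ts|/val_inj -> //].
  by exfalso; apply: (no s t st); rewrite inE; [exact: Es|exact: Et].
by exfalso; apply: (no t s ts); rewrite inE; [exact: Et|exact: Es].
Qed.

(** * Divisibility by a fixed polynomial and the exceptional sign patterns *)

Local Open Scope ring_scope.

Lemma random_coef_setD N (A D : {set primes_upto N}) n :
  (forall a, a \in D -> ~~ (prime_val a %| n)%N) ->
  random_coef (A :\: D) n = random_coef A n.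
Proof.
move=> nD; apply: eq_multiplicative_extension => p; rewrite mem_primes => /and3P[_ _ pn].
congr (_ ^+ nat_of_bool _); apply/exists_inP/exists_inP => -[a aA /eqP ap].
  by exists a; rewrite ?ap //; move: aA; rewrite inE => /andP[].
exists a; rewrite ?ap // inE aA andbT; apply: contraTN pn => /nD.
by rewrite ap.
Qed.

Lemma random_coef_prime N (A : {set primes_upto N}) (a : primes_upto N) :
  random_coef A a = (-1) ^+ (a \in A).
Proof.
have pa := prime_valP a.
rewrite /random_coef /completely_multiplicative_extension primes_prime //.
by rewrite big_seq1 -{3}[prime_val a]expn1 pfactorK // expr1 sign_of_val.
Qed.

(** A prime a > N/2 divides no n <= N other than a itself, so its sign enters the value at z only
    through the term of a, which is nonzero if z is. Littlewood-Offord then gives a threshold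
    uniform in z. *)
Lemma root_count q : exists k0 : nat, forall k : nat, (k0 <= k)%N -> forall z : algC,
  (#|[set A : {set primes_upto (2 ^ k)} |
      root (map_poly intr (partial_sum_poly (sign_of A) (2 ^ k))) z]| * q
    <= 2 ^ #|{: primes_upto (2 ^ k)}|)%N.
Proof.
have [m LO] := littlewood_offord algC q.
have [k0 kP] := many_prime_ords m; exists k0.+1 => -[//|k] le_k z.
set N := (2 ^ k.+1)%N; pose D := [set a : primes_upto N | (2 ^ k < prime_val a)%N].
have evalE (A : {set primes_upto N}) :
    root (map_poly intr (partial_sum_poly (sign_of A) N)) z =
    (\sum_(n < N.+1 | (0 < n)%N) (random_coef A n)%:~R * z ^+ n.-1 == 0).
  rewrite partial_sum_polyE rootE poly_def rmorph_sum horner_sum; congr (_ == 0).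
  rewrite [RHS]big_mkcond big_ord_recl /= add0r; apply: eq_bigr => i _.
  by rewrite map_polyZ /= map_polyXn hornerZ hornerXn.
(* The constant coefficient f(1) is 1 or -1, so 0 is never a root. *)
have [zE|z0] := eqVneq z 0.
  rewrite (_ : [set A | _] = finset.set0) ?cards0 //; apply/finset.setP => A.
  rewrite finset.in_set finset.in_set0 evalE zE; apply/negbTE.
  have N0 : (1 < N.+1)%N by rewrite ltnS expn_gt0.
  rewrite (bigD1 (Ordinal N0)) //= big1 ?addr0 => [|i /andP[i0 i1]].
    by rewrite expr0 mulr1 intr_eq0 -normr_eq0 random_coef_sign.
  rewrite -(inj_eq val_inj) /= in i1; rewrite expr0n.
  by case: (nat_of_ord i) i0 i1 => [|[|?]] //; rewrite mulr0.
pose large (n : nat) := prime n && (2 ^ k < n)%N.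
pose r (X : {set primes_upto N}) : algC :=
  \sum_(n < N.+1 | (0 < n)%N && ~~ large n) (random_coef X n)%:~R * z ^+ n.-1.
have split A : \sum_(n < N.+1 | (0 < n)%N) (random_coef A n)%:~R * z ^+ n.-1 =
    r (A :\: D) + \sum_(a in D) (-1) ^+ (a \in A) * z ^+ (prime_val a).-1.
  rewrite (bigID (fun n : 'I_N.+1 => large n)) /= addrC; congr (_ + _).
    apply: eq_bigr => n /andP[n0 nl]; rewrite random_coef_setD // => a.
    rewrite inE => lo; apply: contraNN nl => /dvdnP[c e].
    have := prime_valP a; have := ltn_ord n; rewrite e in n0 *; rewrite ltnS.
    have N2 : N = (2 * 2 ^ k)%N by rewrite /N expnS.
    case: c n0 {e} => [|[|c]] // _ le_n pa; first by rewrite mul1n /large pa lo.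
    exfalso; have le_2a := leq_mul (isT : (2 <= c.+2)%N) (leqnn (prime_val a)).
    have := leq_trans le_2a (leq_trans le_n (eq_leq N2)).
    by rewrite leq_pmul2l // leqNgt lo.
  rewrite (reindex_omap (J := primes_upto N) val insub) /=; last first.
    by move=> i /andP[_ /andP[pi _]]; rewrite insubT.
  apply: eq_big => [a|a _]; last first.
    by rewrite [random_coef _ _](random_coef_prime A a) rmorph_sign.
  by rewrite valK eqxx andbT inE /large (valP a) prime_gt0 // (valP a).
rewrite (eq_card (B := [set A : {set primes_upto N} |
    (r (A :\: D) + \sum_(a in D) (-1) ^+ (a \in A) * z ^+ (prime_val a).-1 == 0)%R])).
  by apply: LO => [|a _]; [apply: kP|rewrite expf_neq0].
by move=> A; rewrite !finset.in_set evalE split.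
Qed.

(** Coefficients in [-B, B] are stored shifted by B, so that the candidate factors are indexed by a
    finite type. *)
Definition bounded_poly (J B : nat) (c : {ffun 'I_J -> 'I_(2 * B).+1}) : {poly int} :=
  \sum_(l < J) ((c l)%:Z - B%:Z) *: 'X^l.

Lemma bounded_polyP (J B : nat) (g : {poly int}) :
  (size g <= J)%N -> (forall i, `|g`_i| <= B%:Z) ->
  exists c : {ffun 'I_J -> 'I_(2 * B).+1}, g = bounded_poly c.
Proof.
move=> gJ gB; exists [ffun l : 'I_J => inord (absz (g`_l + B%:Z))].
transitivity (\poly_(l < J) g`_l).
  apply/polyP => l; rewrite coef_poly; case: ltnP => // le_l.
  by rewrite nth_default ?(leq_trans gJ).
rewrite poly_def; apply: eq_bigr => l _; congr (_ *: _).
by have := gB l; rewrite ffunE => le_B; rewrite inordK; lia.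
Qed.

(** One complex root of g is a root of every polynomial that g divides. The size condition stands
    inside the set, so that constants are covered and the threshold is uniform in g. *)
Lemma divisor_count (q : nat) : exists k0 : nat, forall k : nat, (k0 <= k)%N ->
  forall g : {poly int},
  (#|[set A : {set primes_upto (2 ^ k)} | (1 < size g)%N &&
      (map_poly (intr : int -> algC) g %|
       map_poly intr (partial_sum_poly (sign_of A) (2 ^ k)))%R]| * q
    <= 2 ^ #|{: primes_upto (2 ^ k)}|)%N.
Proof.
have [k0 kP] := root_count q; exists k0 => k /kP {}kP g.
have [g1|] := boolP (1 < size g)%N; last first.
  by rewrite (eq_card0 (A := [set A | _])) // => A; rewrite finset.in_set.
have [z gz] : exists z, root (map_poly (intr : int -> algC) g) z.
  apply/closed_rootP; rewrite size_map_inj_poly //; first by rewrite (gtn_eqF g1).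
  exact: intr_inj.
apply: leq_trans (kP z); rewrite leq_mul2r; apply/orP; right.
apply/subset_leq_card/fintype.subsetP => A; rewrite !finset.in_set /= => /dvdpP[h ->].
by rewrite rootM gz orbT.
Qed.

Lemma bad_sign_patterns (q : nat) : (0 < q)%N ->
  exists k0 : nat, forall k : nat, (k0 <= k)%N ->
  exists Bad : {set {set primes_upto (2 ^ k)}},
  (#|Bad| * q <= 2 ^ #|{: primes_upto (2 ^ k)}|)%N /\
  forall A, A \notin Bad ->
    irreducible_over_rat (partial_sum_poly (sign_of A) (2 ^ k)).
Proof.
(* Each of two bad sets gets half of 1/q: r = 2q serves the first, and the second is a union over
   candidates whose number does not depend on k. An index t < r gives degree below 2^t <= J and
   coefficients of modulus at most 3^J. *)
move=> q0; pose r := (2 * q)%N; pose J := (2 ^ r)%N.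
pose cand : finType := {ffun 'I_J -> 'I_(2 * 3 ^ J).+1}.
have [k1 k1P] := small_shift_coefs_count r.
have [k2 k2P] := divisor_count (2 * q * #|cand|).
exists (maxn (maxn k1 k2) 1) => k.
rewrite !geq_max => /andP[/andP[/k1P {}k1P /k2P {}k2P] k0].
pose Bad1 := [set A : {set primes_upto (2 ^ k)} |
  [forall t : 'I_r, (4 %| shift_coef A t)%Z]].
pose Bad2 (c : cand) := [set A : {set primes_upto (2 ^ k)} |
  (1 < size (bounded_poly c))%N &&
  (map_poly (intr : int -> algC) (bounded_poly c) %|
   map_poly intr (partial_sum_poly (sign_of A) (2 ^ k)))].
have cand0 : (0 < #|cand|)%N.
  by apply/card_gt0P; exists [ffun=> ord0].
exists (Bad1 :|: \bigcup_(c : cand) Bad2 c); split.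
  have le1 : (#|Bad1| * (2 * q) <= 2 ^ #|{: primes_upto (2 ^ k)}|)%N := k1P.
  have le2 : (#|\bigcup_(c : cand) Bad2 c| * (2 * q) <= 2 ^ #|{: primes_upto (2 ^ k)}|)%N.
    rewrite -(leq_pmul2r cand0) -mulnA.
    apply: (@leq_trans (\sum_(c : cand) #|Bad2 c| * (2 * q * #|cand|))).
      rewrite -big_distrl leq_mul2r /=; apply/orP; right.
      elim/big_rec2: _ => [|c n X _ le_X]; first by rewrite cards0.
      by apply: leq_trans (leq_card_setU _ _) _; rewrite leq_add2l.
    rewrite [leqRHS]mulnC -sum_nat_const; apply: leq_sum => c _.
    exact: k2P.
  have half (s u v w : nat) :
      (u * (2 * q) <= w -> v * (2 * q) <= w -> s <= u + v -> s * q <= w)%N.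
    by move=> uw vw suv; have := leq_mul suv (leqnn q); lia.
  exact: half le1 le2 (leq_card_setU _ _).
move=> A; rewrite finset.in_setU negb_or finset.in_set negb_forall.
case/andP => /existsP[t c4] no2.
rewrite /irreducible_over_rat; rewrite /shift_coef partial_sum_polyE in c4 *.
apply: (irreducible_sign_poly k0 _ c4) => [i _|g h PE g1 gj gB].
  exact: random_coef_sign.
have lt_tJ : (2 ^ t <= J)%N by rewrite leq_exp2l // ltnW.
have t0 : (0 < 2 ^ t)%N by rewrite expn_gt0.
have [||c gc] := @bounded_polyP J (3 ^ J) g.
- by lia.
- move=> i; apply: le_trans (gB i) _.
  by rewrite -[(3 ^ J)%N%:Z]natz natrX ler_weXn2l //; lia.
case/negP: no2; apply/finset.bigcupP; exists c => //.
rewrite finset.in_set -gc g1 partial_sum_polyE PE rmorphM /= dvdp_mulr //.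
Qed.

(** * Probability *)

Local Open Scope classical_set_scope.
Local Open Scope ring_scope.

(** [Q] is a union of joint level sets of the [X i], and these are countably many because the values
    are integers. *)
Lemma measurable_finite_rvs (d : measure_display) (T : measurableType d)
    (I : finType) (X : I -> T -> int) (Q : set T) :
  (forall i, measurable_fun setT (X i)) ->
  (forall w w', (forall i, X i w = X i w') -> Q w -> Q w') -> measurable Q.
Proof.
move=> mX Qw.
pose atom (g : {ffun I -> int}) := \bigcap_(i in [set` enum I]) (X i @^-1` [set g i]).
have -> : Q = \bigcup_g (if `[< exists2 w, Q w & atom g w >] then atom g else set0).
  apply/seteqP; split=> [w Pw|w [g _]].
    exists [ffun i => X i w] => //; have aw : atom [ffun i => X i w] w.
      by move=> i _; rewrite /= ffunE.
    by rewrite ifT //; apply/asboolP; exists w.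
  case: asboolP => // -[w' Qw' w'g] wg; apply: Qw Qw' => i.
  have iI : i \in enum I by rewrite mem_enum.
  by rewrite (w'g i iI) (wg i iI).
apply: countable_bigcupT_measurable => [|g]; first exact: countableP.
case: ifP => // _; rewrite /atom bigcap_seq; apply: bigsetI_measurable => i _.
by rewrite -[X in measurable X]setTI; apply: mX.
Qed.

Definition sign_atom (T : Type) (f : nat -> T -> int) (N : nat)
    (A : {set primes_upto N}) : set T :=
  [set w | forall i : primes_upto N, f i w = sign_of A i].

Section SignAtoms.
Variables (R : realType) (d : measure_display) (T : measurableType d)
  (P : probability T R) (f : nat -> {RV P >-> int}) (N : nat).
Hypotheses (f_indep : mutually_independent prime f)
  (f_unif : forall p : nat, prime p -> uniform_sign (f p)).

Lemma sign_atomE (A : {set primes_upto N}) :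
  sign_atom f A = \big[setI/setT]_(p <- [seq prime_val i | i <- enum {: primes_upto N}])
    (f p @^-1` [set sign_of A p]).
Proof.
rewrite -bigcap_seq; apply/seteqP; split=> [w fw p|w fw i].
  by move=> /mapP[i _ ->]; apply: fw.
by apply: fw; apply/mapP; exists i; rewrite ?mem_enum.
Qed.

Lemma measurable_sign_atom (A : {set primes_upto N}) : measurable (sign_atom f A).
Proof.
rewrite sign_atomE; apply: bigsetI_measurable => p _.
by rewrite -[X in measurable X]setTI; apply: measurable_funPT.
Qed.

Lemma sign_atom_probability (A : {set primes_upto N}) :
  P (sign_atom f A) = ((2^-1 : R) ^+ #|{: primes_upto N}|)%:E.
Proof.
rewrite sign_atomE f_indep.
- rewrite big_map (eq_bigr (fun=> (2^-1 : R)%:E)) => [|i _].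
    rewrite [in RHS]cardE; elim: (enum _) => [|i s IH]; first by rewrite big_nil.
    by rewrite big_cons IH -EFinM exprS.
  have [u1 uN1] := f_unif (prime_valP i).
  by rewrite sign_of_val; case: (i \in A).
- by rewrite map_inj_uniq ?enum_uniq //; apply: prime_val_inj.
- by move=> p /mapP[i _ ->]; apply: prime_valP.
- by [].
Qed.

Lemma trivIset_sign_atom : trivIset setT (sign_atom f (N := N)).
Proof.
move=> A B _ _ [w [wA wB]]; apply/setP => i.
have := wB i; rewrite wA !sign_of_val.
by case: (i \in A); case: (i \in B).
Qed.

(** With n primes up to N, the good patterns give at least 2^n (1 - 1/q) disjoint atoms inside [Q],
    each of probability 2^-n. The atoms may miss a null set, where some sign is neither 1 nor -1. *)
Lemma sign_atoms_lower_bound (Bad : {set {set primes_upto N}}) (Q : set T) (q : nat) :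
  (0 < q)%N -> (#|Bad| * q <= 2 ^ #|{: primes_upto N}|)%N -> measurable Q ->
  (forall A, A \notin Bad -> sign_atom f A `<=` Q) ->
  ((1 - q%:R^-1)%:E <= P Q)%E.
Proof.
move=> q0 Bad_le mQ subQ.
pose F (j : 'I_#|finset.setC Bad|) := sign_atom f (enum_val j).
have mF j : measurable (F j) by apply: measurable_sign_atom.
have tF : trivIset setT F.
  move=> i j _ _ FF; apply/enum_val_inj.
  exact: (trivIset_sign_atom Logic.I Logic.I FF).
apply: (@le_trans _ _ (P (\big[setU/set0]_(j < #|finset.setC Bad|) F j))).
  rewrite measure_bigsetU_ord // (eq_bigr
    (fun=> ((2^-1 : R) ^+ #|{: primes_upto N}|)%:E)).
    rewrite sumEFin sumr_const card_ord lee_fin cardsCs finset.setCK card_setT.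
    rewrite -(mulr_natr (_ ^+ _)) natrB; last first.
      by apply: leq_trans Bad_le; rewrite leq_pmulr.
    rewrite mulrBr natrX -exprMn mulVf ?pnatr_eq0 // expr1n lerD2l lerN2.
    rewrite exprVn mulrC ler_pdivrMr ?exprn_gt0 // mulrC ler_pdivlMr ?ltr0n //.
    by rewrite -natrM -natrX ler_nat.
  by move=> j _; apply: sign_atom_probability.
apply: le_measure; rewrite ?inE //; first exact: bigsetU_measurable.
apply: (big_ind (fun X => X `<=` Q)) => [//|X Y XQ YQ w [/XQ|/YQ] //|j _].
by apply: subQ; have := enum_valP j; rewrite finset.inE.
Qed.
End SignAtoms.

Lemma eq_partial_sum_poly (N : nat) (f g : nat -> int) :
  (forall i : primes_upto N, f i = g i) ->
  partial_sum_poly f N = partial_sum_poly g N.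
Proof.
move=> fg; rewrite !partial_sum_polyE; apply/polyP => i; rewrite !coef_poly.
case: ltnP => // iN; apply: eq_multiplicative_extension => p.
rewrite mem_primes => /and3P[pp _ /(dvdn_leq (ltn0Sn i)) le_p].
have pN : (p < N.+1)%N by rewrite ltnS (leq_trans le_p).
exact: (fg (exist _ (Ordinal pN) pp)).
Qed.

Theorem theorem1p1 (R : realType) (d : measure_display) (T : measurableType d)
    (P : probability T R) (f : nat -> {RV P >-> int})
    (f_indep : mutually_independent prime f)
    (f_unif : forall p : nat, prime p -> uniform_sign (f p)) :
  P [set w | irreducible_over_rat (partial_sum_poly (fun p => f p w) (2 ^ k)%N)]
    @[k --> \oo] --> (1 : R)%:E.
Proof.
set Q := fun k => [set w |
  irreducible_over_rat (partial_sum_poly (fun p => f p w) (2 ^ k)%N)].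
have mQ k : measurable (Q k).
  apply: (measurable_finite_rvs
    (X := fun (i : primes_upto (2 ^ k)) w => f i w)) => [i|w w' ww'].
    exact: measurable_funPT.
  move=> Qw; exact: (eq_ind _ irreducible_over_rat Qw _ (eq_partial_sum_poly ww')).
have finQ k : P (Q k) \is a fin_num by apply: fin_num_measure.
apply/fine_cvgP; split; first by apply: nearW.
apply/cvgrPdist_le => e e0.
have [q q0 qe] : exists2 q : nat, (0 < q)%N & (q%:R : R)^-1 <= e.
  exists (Num.truncn e^-1).+1 => //.
  by rewrite invf_ple ?posrE ?ltr0n // ltW // truncnS_gt.
have [k0 k0P] := bad_sign_patterns q0.
exists k0 => // k /= /k0P[Bad [Bad_le BadP]].
have lo : ((1 - q%:R^-1)%:E <= P (Q k))%E.
  apply: (sign_atoms_lower_bound f_indep f_unif q0 Bad_le (mQ k)) => A /BadP irrA w wA.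
  exact: (eq_ind_r irreducible_over_rat irrA (eq_partial_sum_poly wA)).
have hi := probability_le1 P (mQ k).
rewrite -(fineK (finQ k)) !lee_fin in lo hi.
(* As the probability is at most 1, its distance to 1 is at most 1/q <= e by the lower bound. *)
rewrite ger0_norm ?subr_ge0 // lerBlDr -lerBlDl.
by apply: le_trans lo; rewrite lerB.
Qed.
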